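(* Let $p$ be a prime, $d\ge1$ an integer, and let $a=\sum_{i=0}^{d-1}a_ip^i$ with $a_0\bmod p\neq0$, so that $a$ is coprime to $p^d$. Consider the Bezout identity $ax+p^dy=1$. (i) If $x,y$ satisfy $ax+p^dy=1$, so that $axb+p^dyb=b$, then $xb$, $yb$ give solutions of the Bezout identity with right hand side $b$. (ii) The unique solutions $x_i,y_i$ ($0\le i\le d-1$) for the coefficients of the solutions $x=\sum_{i=0}^{d-1}x_ip^i$, $y=\sum_{i=0}^{d-1}y_ip^i$ of $ax+p^dy=1$ modulo $p^d$ are given by the following iterations: $$t_0:=(a_0x_0),\qquad t_0=1 \bmod p;$$ for $k=1,2,\dots,d-1$: $$t_k:=[t_{k-1}]+(a_0x_k+a_1x_{k-1}+\dots+a_kx_0),\qquad t_k=0 \bmod p;$$ for $j=0,1,\dots,d-1$: $$t_{d+j}:=[t_{d-1+j}]+a_1x_{d-1+j}+a_2x_{d-2+j}+\dots+a_{d-1}x_{1+j},\qquad t_{d+j}+y_j=0 \bmod p.$$ (iii) Given the solutions $x,y$ in $\mathbb{Z}/(p^d)$, an integral solution to the Bezout identity is given by $ax+p^d(y-t)=1$, where the integer $t$ exists because $ax+p^dy=1 \bmod p^d$.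
   Context: The numbers $a,b,x,y$ are elements of $\mathbb{Z}/(p^d)$ written in $p$-adic representation with digits $a_i,b_i,x_i,y_i\in[0,p-1]$, $0\le i\le d-1$; accordingly $x_i=0$ for $i\ge d$. For a number $z$, $(z)=z\bmod p$ denotes the residue and $[z]$ denotes the quotient of $z$ on division by $p$ (the carry). An expression ''$u=v\bmod p$'' is the congruence $u\equiv v\pmod p$.
   Formalization: In (ii) the parentheses in t_0 and t_k are read as grouping, since as residues mod p the carries vanish and the claim fails (p=3, d=2, a=2); x is unique as a solution mod p^d, but y only as a solution of the iteration, because every y solves the congruence mod p^d. *)

(* Defs.v *)
From mathcomp Require Import all_boot all_order all_algebra.
Set Implicit Arguments.
Unset Strict Implicit.
Unset Printing Implicit Defensive.

Local Open Scope nat_scope.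

(* An element of Z/(p^d) is given by the d-tuple of its p-adic digits; the
   numerical value is its representative in [0, p^d). *)

(* The digit is 0 for i >= d. *)
Definition digit (p d : nat) (x : d.-tuple 'I_p) (i : nat) : nat :=
  nth 0 [seq val c | c <- x] i.

Definition value (p d : nat) (x : d.-tuple 'I_p) : nat :=
  \sum_(i < d) digit x i * p ^ i.

(* t_k, with [t] = t %/ p.  The parentheses in t_0 := (a_0 x_0) and in
   t_k := [t_(k-1)] + (a_0 x_k + ... + a_k x_0) only group: reading them as
   residues mod p would lose the carries. *)
Fixpoint bezout_term (p d : nat) (a x : d.-tuple 'I_p) (k : nat) : nat :=
  if k is l.+1 then
    bezout_term a x l %/ p +
      (if k < d then \sum_(0 <= i < k.+1) digit a i * digit x (k - i)
       else \sum_(1 <= i < d) digit a i * digit x (k - i))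
  else digit a 0 * digit x 0.

Definition bezout_iteration (p d : nat) (a x y : d.-tuple 'I_p) : Prop :=
  let t := bezout_term a x in
  [/\ t 0 = 1 %[mod p],
      forall k, 1 <= k < d -> t k = 0 %[mod p] &
      forall j, j < d -> t (d + j) + digit y j = 0 %[mod p]].

Definition bezout_mod (p d : nat) (a x y : d.-tuple 'I_p) : Prop :=
  value a * value x + p ^ d * value y = 1 %[mod p ^ d].

(* Main.v *)
(** With carries propagated, the first d columns of the schoolbook product of a
    and x have digits t_k mod p, so the conditions on t_0, ..., t_(d-1) say
    exactly that these are the base-p digits of 1, i.e. a x = 1 mod p^d. Hence x
    exists and is unique because a is a unit mod p^d, and the remaining
    conditions determine each y_j separately, as the residue of -t_(d+j). *)
Require Import Defs.
From mathcomp Require Import all_boot all_order all_algebra.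
From mathcomp Require Import ring.
Import GRing.Theory.

Lemma big_expn_recl (q n : nat) (f : nat -> nat) :
  \sum_(i < n.+1) f i * q ^ i = f 0 + q * \sum_(i < n) f i.+1 * q ^ i.
Proof.
rewrite big_ord_recl /= expn0 muln1 big_distrr /=; congr addn.
by apply: eq_bigr => i _; rewrite /bump /= add1n expnS mulnCA.
Qed.

(** Reduction mod [p] isolates the lowest digit; cancelling it and dividing by [p] leaves the
    shifted sequences for the induction. *)
Lemma base_inj (p n : nat) (f g : nat -> nat) :
    (forall i, i < n -> f i < p) -> (forall i, i < n -> g i < p) ->
  \sum_(i < n) f i * p ^ i = \sum_(i < n) g i * p ^ i ->
  forall i, i < n -> f i = g i.
Proof.
elim: n f g => [//|n IHn] f g fp gp; rewrite !big_expn_recl => eq_fg.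
have f0p := fp 0 isT; have g0p := gp 0 isT.
have p_gt0 : 0 < p by apply: leq_trans f0p.
have eq0 : f 0 = g 0.
  by move: (congr1 (modn^~ p) eq_fg);
    rewrite !(mulnC p) !(addnC _ (_ * p)) !modnMDl !modn_small.
case=> [//|i] lt_in; apply: (IHn (f \o succn) (g \o succn)) => //=.
- by move=> j; apply: (fp j.+1).
- by move=> j; apply: (gp j.+1).
by move/eqP: eq_fg; rewrite eq0 eqn_add2l eqn_pmul2l // => /eqP.
Qed.

Lemma base_ltn (p n : nat) (f : nat -> nat) :
  (forall i, i < n -> f i < p) -> \sum_(i < n) f i * p ^ i < p ^ n.
Proof.
elim: n => [|n IHn] fp; first by rewrite big_ord0.
have lt_n := IHn (fun i lt_in => fp i (ltnW lt_in)).
rewrite big_ord_recr /= expnS.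
apply: (@leq_trans (p ^ n + f n * p ^ n)); first by rewrite ltn_add2r.
by rewrite -mulSn leq_mul2r fp ?orbT.
Qed.

Lemma base_expansion (p n N : nat) :
  \sum_(i < n) (N %/ p ^ i %% p) * p ^ i + N %/ p ^ n * p ^ n = N.
Proof.
elim: n => [|n IHn]; first by rewrite big_ord0 divn1 muln1.
rewrite -[in RHS]IHn big_ord_recr /= -addnA; congr addn.
by rewrite [in RHS](divn_eq (N %/ p ^ n) p) -divnMA -expnSr expnS; ring.
Qed.

(** Induction peels off [f 0]: each later convolution coefficient is [f 0 * g k.+1] plus the
    coefficient for the shifted [f]. The [f 0] terms reassemble into [f 0 * G], which cancels. *)
Lemma modn_cauchy (q n : nat) (f g : nat -> nat) :
  (\sum_(i < n) f i * q ^ i) * (\sum_(i < n) g i * q ^ i) =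
  \sum_(k < n) (\sum_(0 <= i < k.+1) f i * g (k - i)) * q ^ k %[mod q ^ n].
Proof.
elim: n f => [|n IHn] f; first by rewrite !big_ord0.
set G := \sum_(i < n.+1) g i * q ^ i.
rewrite (big_expn_recl _ _ f).
rewrite (big_expn_recl _ _ (fun k => \sum_(0 <= i < k.+1) f i * g (k - i))).
rewrite big_nat1 subn0.
have -> : \sum_(k < n) (\sum_(0 <= i < k.+2) f i * g (k.+1 - i)) * q ^ k =
    f 0 * (\sum_(k < n) g k.+1 * q ^ k) +
    \sum_(k < n) (\sum_(0 <= i < k.+1) f i.+1 * g (k - i)) * q ^ k.
  rewrite big_distrr -big_split /=; apply: eq_bigr => k _.
  by rewrite big_nat_recl // subn0 mulnDl mulnA.
rewrite mulnDr addnA (mulnCA q).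
rewrite -mulnDr -(big_expn_recl _ _ g) -/G mulnDl.
apply/eqP; rewrite eqn_modDl; apply/eqP.
(* A factor [q] comes out of both sides and of the modulus. Modulo [q ^ n] the top term of [G] then
   vanishes, which gives the form of the induction hypothesis. *)
rewrite expnS -mulnA -!muln_modr; congr muln.
rewrite /G big_ord_recr /= mulnDr mulnA addnC modnMDl.
exact: (IHn (f \o succn)).
Qed.

(** Schoolbook carrying: column [k] keeps [T k %% p] and passes [T k %/ p] on to the next column.
    Only the last column is left unreduced. *)
Lemma carry_sum (p n : nat) (s T : nat -> nat) :
    T 0 = s 0 -> (forall k, k < n -> T k.+1 = T k %/ p + s k.+1) ->
  \sum_(k < n.+1) s k * p ^ k =
  \sum_(k < n) (T k %% p) * p ^ k + T n * p ^ n.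
Proof.
move=> T0; elim: n => [|n IHn] TS.
  by rewrite big_ord_recr !big_ord0 /= T0.
rewrite big_ord_recr /= IHn; last by move=> k /ltnW; apply: TS.
rewrite [in RHS]big_ord_recr /= TS // [in LHS](divn_eq (T n) p) expnS; ring.
Qed.

(** The final carry has weight [p ^ n.+1], so it disappears. What remains and 1 both lie below the
    modulus, so the congruence is an equality, and base-[p] digits are unique. *)
Lemma carry_eq1_mod (p n : nat) (s T : nat -> nat) :
    1 < p -> T 0 = s 0 -> (forall k, k < n -> T k.+1 = T k %/ p + s k.+1) ->
  \sum_(k < n.+1) s k * p ^ k = 1 %[mod p ^ n.+1] <->
  forall k, k < n.+1 -> T k %% p = (k == 0).
Proof.
move=> p_gt1 T0 TS; have p_gt0 := ltnW p_gt1.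
have Tp k : k < n.+1 -> T k %% p < p by rewrite ltn_mod.
have dp k : k < n.+1 -> (k == 0) < p by case: k.
have one : \sum_(k < n.+1) (k == 0 :> nat) * p ^ k = 1.
  by rewrite (big_expn_recl p n (fun k => k == 0)) big1 ?muln0.
have sumE : \sum_(k < n.+1) s k * p ^ k =
    \sum_(k < n.+1) (T k %% p) * p ^ k %[mod p ^ n.+1].
  rewrite (carry_sum p n s T) // big_ord_recr /= {1}(divn_eq (T n) p).
  by rewrite mulnDl -mulnA -expnS addnCA modnMDl.
have lt1 : 1 < p ^ n.+1 by rewrite -(exp1n n.+1) ltn_exp2r.
rewrite sumE !modn_small ?(base_ltn _ _ (fun k => T k %% p)) //.
rewrite -[in X in X <-> _]one; split=> [|TE].
  exact: (base_inj p n.+1 (fun k => T k %% p) (fun k => (k == 0) : nat)).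
by apply: eq_bigr => k _; rewrite TE.
Qed.

Section Digits.
Variables p d : nat.
Implicit Types x y a : d.-tuple 'I_p.

Lemma digitE x (i : 'I_d) : digit x i = tnth x i.
Proof. by rewrite /digit -tnth_map -tnth_nth ?size_map. Qed.

Lemma digit_inj x y : (forall i, i < d -> digit x i = digit y i) -> x = y.
Proof.
move=> eq_xy; apply: eq_from_tnth => i; apply: val_inj.
by rewrite /= -!digitE eq_xy.
Qed.

Lemma ltn_digit x i : i < d -> digit x i < p.
Proof. by move=> lt_id; rewrite -[i]/(val (Ordinal lt_id)) digitE. Qed.

Lemma tuple_of_digits (f : nat -> nat) : 0 < p ->
  exists x, forall i, i < d -> digit x i = f i %% p.
Proof.
move=> p_gt0.
exists [tuple Ordinal (ltn_pmod (f i) p_gt0) | i < d] => i lt_id.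
by rewrite -[i]/(val (Ordinal lt_id)) digitE tnth_mktuple.
Qed.

Lemma value_inj x y : value x = value y -> x = y.
Proof. by move=> /base_inj eq_xy; apply/digit_inj/eq_xy; apply: ltn_digit. Qed.

Lemma ltn_value x : value x < p ^ d.
Proof. by apply: base_ltn; apply: ltn_digit. Qed.

Lemma value_surj (N : nat) : 0 < p -> exists x, value x = N %% p ^ d.
Proof.
move=> p_gt0; have [x xE] := tuple_of_digits (fun i => N %/ p ^ i) p_gt0.
exists x; rewrite -{1}(base_expansion p d N) addnC modnMDl.
rewrite -(modn_small (ltn_value x)).
by congr modn; apply: eq_bigr => i _; rewrite xE.
Qed.

Lemma value_digit0 x : 0 < d -> value x = digit x 0 %[mod p].
Proof.
by case: d x => // n x _; rewrite /value big_expn_recl mulnC addnC modnMDl.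
Qed.

Lemma coprime_value a :
  prime p -> 0 < d -> digit a 0 <> 0 %[mod p] -> coprime (value a) (p ^ d).
Proof.
rewrite mod0n => p_pr d_gt0 /eqP a0.
rewrite coprime_sym coprimeXl // prime_coprime //.
by rewrite /dvdn value_digit0.
Qed.

Lemma bezout_modE a x y :
  bezout_mod a x y <-> value a * value x = 1 %[mod p ^ d].
Proof. by rewrite /bezout_mod addnC mulnC modnMDl. Qed.

Lemma bezout_term_eq1_mod a x : 1 < p -> 0 < d ->
  value a * value x = 1 %[mod p ^ d] <->
  forall k, k < d -> bezout_term a x k %% p = (k == 0).
Proof.
move=> p_gt1 d_gt0; rewrite /value modn_cauchy.
have := carry_eq1_mod p d.-1
  (fun k => \sum_(0 <= i < k.+1) digit a i * digit x (k - i)) (bezout_term a x).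
rewrite (prednK d_gt0); apply=> // [|k lt_kd]; first by rewrite big_nat1.
(* For [k < d.-1] the recursion at [k.+1] takes the branch with the full convolution column. *)
by rewrite /= -ltn_predRL lt_kd.
Qed.

Lemma bezout_iterationE a x y : 1 < p -> 0 < d ->
  bezout_iteration a x y <->
  value a * value x = 1 %[mod p ^ d] /\
  forall j, j < d -> bezout_term a x (d + j) + digit y j = 0 %[mod p].
Proof.
move=> p_gt1 d_gt0; rewrite bezout_term_eq1_mod //; split.
  case=> t0 tk ty; split=> // -[|k] lt_kd; first by rewrite t0 modn_small.
  by rewrite tk // mod0n.
case=> tk ty; split=> // [|k /andP[k_gt0 lt_kd]].
  by rewrite tk // modn_small.
by rewrite tk // mod0n -(prednK k_gt0).
Qed.

(** Uniqueness of inverses: modulo [p ^ d], x' = (a x) x' = (a x') x = x, and values below [p ^ d]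
    determine their digits. *)
Lemma bezout_mod_inj a x x' :
  value a * value x = 1 %[mod p ^ d] -> value a * value x' = 1 %[mod p ^ d] ->
  x' = x.
Proof.
move=> ax ax'; apply: value_inj.
rewrite -(modn_small (ltn_value x')) -(modn_small (ltn_value x)).
rewrite -[value x']mul1n -[value x]mul1n -(modnMml 1) -(modnMml 1) -{1}ax -ax'.
by rewrite !modnMml mulnAC.
Qed.

Lemma bezout_exists a : 1 < p -> coprime (value a) (p ^ d) ->
  exists x, value a * value x = 1 %[mod p ^ d].
Proof.
move=> p_gt1 co_a; have p_gt0 := ltnW p_gt1.
(* The extended Euclidean algorithm below needs a positive argument; zero is coprime to [p ^ d] only
   for modulus 1, where any [x] works. *)
have [a_eq0|a_gt0] := posnP (value a).
  have pd1 : p ^ d = 1 by move: co_a; rewrite a_eq0 /coprime gcd0n => /eqP.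
  by have [x _] := value_surj 0 p_gt0; exists x; rewrite pd1 !modn1.
have [u v uvE _] := egcdnP (p ^ d) a_gt0.
have [x xE] := value_surj u p_gt0; exists x.
by rewrite xE modnMmr mulnC uvE modnMDl (eqP co_a).
Qed.

Lemma bezout_tail_unique a x : 0 < p ->
  exists2 y, forall j, j < d -> bezout_term a x (d + j) + digit y j = 0 %[mod p]
    & forall y',
      (forall j, j < d -> bezout_term a x (d + j) + digit y' j = 0 %[mod p]) ->
      y' = y.
Proof.
move=> p_gt0; set t := bezout_term a x.
(* The negative of the residue; [tuple_of_digits] reduces again mod [p], turning the value [p] into
   0 when the residue is 0. *)
have [y yE] := tuple_of_digits (fun j => p - t (d + j) %% p) p_gt0.
have yP j : j < d -> t (d + j) + digit y j = 0 %[mod p].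
  move=> lt_jd; rewrite yE // modnDmr -modnDml subnKC ?modnn ?mod0n //.
  by rewrite ltnW // ltn_mod.
exists y => // y' y'P; apply: digit_inj => j lt_jd.
rewrite -(modn_small (ltn_digit y' _ lt_jd)).
rewrite -(modn_small (ltn_digit y _ lt_jd)).
by apply/eqP; rewrite -(eqn_modDl (t (d + j))) y'P ?yP.
Qed.
End Digits.

Theorem lemma3 (p d : nat) (p_pr : prime p) (d_ge1 : (1 <= d)%N)
    (a : d.-tuple 'I_p) (a0 : digit a 0 <> 0 %[mod p]) :
  let A : int := Posz (value a) in
  let P : int := Posz (p ^ d) in
  coprime (value a) (p ^ d) /\
  (* (i) over the integers and over Z/(p^d) *)
  ((forall b x y : int,
      (A * x + P * y = 1)%R -> (A * (x * b) + P * (y * b) = b)%R) /\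
   (forall b x y : int,
      ((A * x + P * y)%R = 1 %[mod P])%Z ->
      ((A * (x * b) + P * (y * b))%R = b %[mod P])%Z)) /\
  (* (ii) *)
  (exists x y : d.-tuple 'I_p,
     [/\ bezout_iteration a x y,
         bezout_mod a x y,
         forall x' y' : d.-tuple 'I_p,
           bezout_iteration a x' y' -> x' = x /\ y' = y &
         forall x' y' : d.-tuple 'I_p, bezout_mod a x' y' -> x' = x]) /\
  (* (iii) *)
  (forall x y : d.-tuple 'I_p, bezout_mod a x y ->
     exists t : int, (A * Posz (value x) + P * (Posz (value y) - t) = 1)%R).
Proof.
have p_gt1 := prime_gt1 p_pr; have p_gt0 := prime_gt0 p_pr.
have co_a := coprime_value _ _ _ p_pr d_ge1 a0.
move=> A P; split=> //; split; [split|split].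
- by move=> b x y xyE; rewrite !mulrA -mulrDl xyE mul1r.
- by move=> b x y xyE; rewrite !mulrA -mulrDl -modzMml xyE modzMml mul1r.
- have [x ax] := bezout_exists _ _ _ p_gt1 co_a.
  have [y ty yU] := bezout_tail_unique _ _ a x p_gt0.
  exists x, y; split.
  + exact/bezout_iterationE.
  + exact/bezout_modE.
  + move=> x' y' /bezout_iterationE[]// ax'.
    have -> := bezout_mod_inj _ _ _ _ _ ax ax'.
    by move=> /yU.
  by move=> x' y' /bezout_modE; apply: bezout_mod_inj.
move=> x y; rewrite /bezout_mod => xyE.
have pd_gt1 : 1 < p ^ d by rewrite -(exp1n d) ltn_exp2r.
(* The integer t is the quotient of this division, whose remainder is 1 because [1 < p ^ d]. *)
have := divn_eq (value a * value x + p ^ d * value y) (p ^ d).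
rewrite xyE modn_small // => /(congr1 Posz).
set q := _ %/ _; rewrite !PoszD !PoszM -/A -/P => E.
exists (Posz q); rewrite mulrBr addrA E; ring.
Qed.
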